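(* Let $m\geq 1$ be a positive integer and $Y=\{y_1,\dots,y_m\}$ a set of $m$ elements. The pair $(\mathrm{SMQSym}^{\widetilde{\mathbb N}}([m]),P)$, together with the injection $$Y\hookrightarrow\mathrm{SMQSym}^{\widetilde{\mathbb N}}([m]),\qquad y_i\mapsto x_{1,0}^{\varepsilon}\cdots x_{i-1,0}^{\varepsilon}\,x_{i,0}\,x_{i+1,0}^{\varepsilon}\cdots x_{m,0}^{\varepsilon},$$ is the free commutative Rota-Baxter algebra of weight $1_{\mathbf k}$ on the set $Y$.
   Context: $\mathbf k$ is a commutative unitary ring containing $\mathbb Q$; algebras are unitary and associative over $\mathbf k$; $[m]=\{1,\dots,m\}$, $\mathbb N=\{0,1,\dots\}$, $\mathbb P=\{1,2,\dots\}$. Rota-Baxter algebras. A Rota-Baxter algebra of weight $\lambda\in\mathbf k$ is a $\mathbf k$-algebra $R$ with a linear operator $P:R\to R$ satisfying $P(x)P(y)=P(xP(y))+P(P(x)y)+\lambda P(xy)$ for all $x,y\in R$; it is commutative if $R$ is. Morphisms are $\mathbf k$-algebra homomorphisms commuting with the operators. A commutative Rota-Baxter algebra $(F,P_F)$ of weight $\lambda$ with a map $j:Y\to F$ is the free commutative Rota-Baxter algebra of weight $\lambda$ on the set $Y$ if for every commutative Rota-Baxter algebra $(R,P)$ of weight $\lambda$ and every map $f:Y\to R$ there is a unique morphism of Rota-Baxter algebras $\bar f:F\to R$ with $\bar f\circ j=f$. Exponents. $\widetilde{\mathbb N}=\mathbb N\sqcup\{\varepsilon\}$ is the commutative monoid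 extending addition on $\mathbb N$ by $0+\varepsilon=\varepsilon+0=\varepsilon+\varepsilon=\varepsilon$ and $n+\varepsilon=\varepsilon+n=n$ for $n\ge1$; $\widetilde{\mathbb P}=\mathbb P\sqcup\{\varepsilon\}\subset\widetilde{\mathbb N}$. $[m]^{\widetilde{\mathbb P}}$ is the set of maps $[m]\to\widetilde{\mathbb P}$; the map constantly equal to $\varepsilon$ is denoted $[m]^{\varepsilon}$. $W\mathcal{MC}(\widetilde{\mathbb N})$ is the set of finite sequences $\mathbf w=(w_1,\dots,w_n)$, $n\ge0$, with all $w_i\in[m]^{\widetilde{\mathbb P}}$; the empty sequence is $\mathbb 1$. Power series. Let $X=\{x_{i,j}\mid i\in[m],j\in\mathbb P\}$, $X_0=\{x_{1,0},\dots,x_{m,0}\}$, $\overline X=X_0\sqcup X$. Monomials with exponents in $\widetilde{\mathbb N}$ are finitely supported maps $\overline X\to\widetilde{\mathbb N}$, written $\prod x_{i,j}^{a_{i,j}}$ ($x^0=1$, but $x^\varepsilon\neq1$), multiplied by adding exponents; $\mathbf k[[\overline X]]^{\widetilde{\mathbb N}}$ is the algebra of possibly infinite $\mathbf k$-linear combinations of these. For $w\in[m]^{\widetilde{\mathbb P}}$ and $j\in\mathbb P$ let $x_j^w=\prod_{i\in[m]}x_{i,j}^{w(i)}$ and $x_{w,0}=\prod_{i\in[m]}x_{i,0}^{w(i)}$. For $\mathbf w=(w_1,\dots,w_n)\in W\mathcal{MC}(\widetilde{\mathbb N})$ let $M_{\mathbf w}=\sum_{1\le j_1<\cdots<j_n}x_{j_1}^{w_1}\cdots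 x_{j_n}^{w_n}$, $M_{\mathbb 1}=1$; $\mathrm{WMQSym}$ is the span of these $M_{\mathbf w}$ (an algebra). The algebra $\mathrm{SMQSym}^{\widetilde{\mathbb N}}([m])$. It is $x_{[m]^\varepsilon,0}\,\mathbf k[X_0]\,\mathrm{WMQSym}\subset\mathbf k[[\overline X]]^{\widetilde{\mathbb N}}$, where $x_{[m]^{\varepsilon},0}=x_{1,0}^\varepsilon\cdots x_{m,0}^\varepsilon$; equivalently the free $\mathbf k$-module with basis the elements $\overline M_{(w,\mathbf w)}:=x_{w,0}M_{\mathbf w}$, $w\in[m]^{\widetilde{\mathbb P}}$, $\mathbf w\in W\mathcal{MC}(\widetilde{\mathbb N})$. It is closed under multiplication and is an algebra with identity element the idempotent $x_{[m]^\varepsilon,0}$ (not the identity of $\mathbf k[[\overline X]]^{\widetilde{\mathbb N}}$). Writing $(w,\mathbf w)=(w,w_1,\dots,w_n)$ for the concatenated sequence, the operator $P$ is the linear map on $\mathrm{SMQSym}^{\widetilde{\mathbb N}}([m])$ with $P(\overline M_{(w,\mathbf w)})=\overline M_{([m]^\varepsilon,w,\mathbf w)}$, i.e. $P(x_{w,0}M_{\mathbf w})=x_{[m]^\varepsilon,0}M_{(w,\mathbf w)}$. *)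

(* Defs.v *)
From HB Require Import structures.
From mathcomp Require Import all_boot all_order all_algebra.
From mathcomp Require Import finmap ring.
From mathcomp Require Import boolp classical_sets functions cardinality fsbigop.

Set Implicit Arguments.
Unset Strict Implicit.
Unset Printing Implicit Defensive.

Import GRing.Theory.
Local Open Scope classical_set_scope.
Local Open Scope ring_scope.

Variant Ntilde := Fin of nat | Eps.

Definition option_of_Ntilde (x : Ntilde) : option nat :=
  if x is Fin n then Some n else None.

Definition Ntilde_of_option (x : option nat) : Ntilde :=
  if x is Some n then Fin n else Eps.

Lemma option_of_NtildeK : cancel option_of_Ntilde Ntilde_of_option.
Proof. by case. Qed.

HB.instance Definition _ :=
  Countable.copy Ntilde (can_type option_of_NtildeK).

Definition Ntilde_add (x y : Ntilde) : Ntilde :=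
  match x, y with
  | Fin n, Fin p => Fin (n + p)
  | Fin 0, Eps => Eps
  | Eps, Fin 0 => Eps
  | Fin n, Eps => Fin n
  | Eps, Fin n => Fin n
  | Eps, Eps => Eps
  end.

Lemma Ntilde_addA : associative Ntilde_add.
Proof.
by do 3![case=> [[|?]|]] => //=; rewrite ?addn0 ?addSn ?addnS ?addnA.
Qed.

Lemma Ntilde_addC : commutative Ntilde_add.
Proof. by do 2![case=> [[|?]|]] => //=; rewrite addnC. Qed.

Lemma Ntilde_add0 : left_id (Fin 0) Ntilde_add.
Proof. by case. Qed.

HB.instance Definition _ :=
  GRing.isNmodule.Build Ntilde Ntilde_addA Ntilde_addC Ntilde_add0.

Lemma FinD n p : Fin n + Fin p = Fin (n + p).
Proof. by case: n. Qed.

Definition Ptilde := {x : Ntilde | x != 0}.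

Definition peps : Ptilde := exist (fun x : Ntilde => x != 0) Eps isT.

Definition pone : Ptilde := exist (fun x : Ntilde => x != 0) (Fin 1) isT.

Definition wexp (m : nat) := {ffun 'I_m -> Ptilde}.

Definition weps m : wexp m := [ffun=> peps].

(* The variable x_{i,j} is encoded by the pair (i, j) : 'I_m * nat, so that
   X_0 is the set of pairs (i, 0) and X the set of pairs (i, j) with 0 < j.
   A monomial is the map sending each variable to its exponent, and the
   product of monomials is written additively. *)
Definition mono (m : nat) := {fsfun 'I_m * nat -> Ntilde with 0}.

HB.instance Definition _ m := Choice.on (mono m).

Section MonoidOfMonomials.
Variable m : nat.
Implicit Types a b c : mono m.

Definition mono_add a b : mono m :=
  [fsfun x in (finsupp a `|` finsupp b)%fset => a x + b x | 0].

Definition mono0 : mono m := [fsfun with 0].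

Lemma mono_addE a b x : mono_add a b x = a x + b x.
Proof.
rewrite fsfunE; case: ifP => // /negbT; rewrite inE negb_or => /andP[xa xb].
by rewrite !fsfun_dflt // addr0.
Qed.

Lemma mono_addA : associative mono_add.
Proof. by move=> a b c; apply/fsfunP => x; rewrite !mono_addE addrA. Qed.

Lemma mono_addC : commutative mono_add.
Proof. by move=> a b; apply/fsfunP => x; rewrite !mono_addE addrC. Qed.

Lemma mono_add0 : left_id mono0 mono_add.
Proof. by move=> a; apply/fsfunP => x; rewrite mono_addE fsfunE add0r. Qed.

HB.instance Definition _ :=
  GRing.isNmodule.Build (mono m) mono_addA mono_addC mono_add0.

Lemma monoD a b x : (a + b) x = a x + b x.
Proof. exact: mono_addE. Qed.

Lemma monoE0 x : (0 : mono m) x = 0.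
Proof. exact: fsfun0E. Qed.

Lemma Ntilde_addr_eq0 (x y : Ntilde) : (x + y == 0) = (x == 0) && (y == 0).
Proof. by case: x y => [[|x]|] [[|y]|]. Qed.

Lemma mono_addr_eq0 a b : (a + b == 0) = (a == 0) && (b == 0).
Proof.
apply/eqP/andP => [ab0|[/eqP-> /eqP->]]; last by rewrite addr0.
have ab0x x : (a x == 0) && (b x == 0).
  by rewrite -Ntilde_addr_eq0 -monoD ab0 monoE0.
by split; apply/eqP/fsfunP => x; case/andP: (ab0x x) => /eqP ? /eqP ?;
  rewrite monoE0.
Qed.

Definition nat_of_Ntilde (x : Ntilde) := if x is Fin n then n else 0%N.

Lemma nat_of_NtildeD x y :
  nat_of_Ntilde (x + y) = (nat_of_Ntilde x + nat_of_Ntilde y)%N.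
Proof. by case: x y => [[|x]|] [[|y]|] //=; rewrite addn0. Qed.

Lemma mono_divisors_finite c : finite_set [set a | exists b, a + b = c].
Proof.
pose N := \max_(x <- finsupp c) nat_of_Ntilde (c x).
pose val_of (o : option 'I_N.+1) := if o is Some i then Fin i else Eps.
pose g (h : {ffun finsupp c -> option 'I_N.+1}) : mono m :=
  [fsfun x : finsupp c => val_of (h x) | 0].
apply: (@sub_finite_set _ _ (g @` setT)); last first.
  by apply: finite_image; exact: finite_finset.
move=> a [b abc].
exists [ffun x : finsupp c => if a (val x) is Fin n then Some (inord n) else None].
  by [].
apply/fsfunP => x; rewrite fsfun_ffun; case: insubP => [u xc ux|xc] /=; last first.
  move: (fsfun_dflt xc); rewrite -abc monoD => /eqP.
  by rewrite Ntilde_addr_eq0 => /andP[/eqP->].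
rewrite ffunE ux; case Eax : (a x) => [n|] //=.
rewrite inordK // ltnS; apply: (@leq_trans (nat_of_Ntilde (c x))).
  by rewrite -abc monoD nat_of_NtildeD Eax leq_addr.
by rewrite /N (big_fsetD1 x) //= leq_maxl.
Qed.

End MonoidOfMonomials.

(* k[[\bar X]]^{\tilde N}: a series is the family of its coefficients. *)
Definition pseries (k : comNzRingType) (m : nat) := mono m -> k.

Section PowerSeries.
Variables (k : comNzRingType) (m : nat).
Local Notation ps := (pseries k m).
Implicit Types (f g h : ps) (a b c d : mono m).

HB.instance Definition _ := gen_eqMixin ps.
HB.instance Definition _ := gen_choiceMixin ps.

Definition ps0 : ps := fun=> 0.
Definition psopp f : ps := fun c => - f c.
Definition psadd f g : ps := fun c => f c + g c.
Definition psscale (x : k) f : ps := fun c => x * f c.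

Lemma psaddA : associative psadd.
Proof. by move=> f g h; apply/funext => c; rewrite /psadd addrA. Qed.
Lemma psaddC : commutative psadd.
Proof. by move=> f g; apply/funext => c; rewrite /psadd addrC. Qed.
Lemma psadd0 : left_id ps0 psadd.
Proof. by move=> f; apply/funext => c; rewrite /psadd add0r. Qed.
Lemma psaddN : left_inverse ps0 psopp psadd.
Proof. by move=> f; apply/funext => c; rewrite /psadd addNr. Qed.

HB.instance Definition _ := GRing.isZmodule.Build ps psaddA psaddC psadd0 psaddN.

Lemma psscaleA x y f : psscale x (psscale y f) = psscale (x * y) f.
Proof. by apply/funext => c; rewrite /psscale mulrA. Qed.
Lemma psscale1 : left_id 1 psscale.
Proof. by move=> f; apply/funext => c; rewrite /psscale mul1r. Qed.
Lemma psscaleDr : right_distributive psscale +%R.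
Proof. by move=> x f g; apply/funext => c; rewrite /psscale -mulrDr. Qed.
Lemma psscaleDl f : {morph psscale^~ f : x y / x + y}.
Proof. by move=> x y; apply/funext => c; rewrite /psscale mulrDl. Qed.

HB.instance Definition _ :=
  GRing.Zmodule_isLmodule.Build k ps psscaleA psscale1 psscaleDr psscaleDl.

Lemma psD f g c : (f + g) c = f c + g c. Proof. by []. Qed.
Lemma psE0 c : (0 : ps) c = 0. Proof. by []. Qed.
Lemma psZ x f c : (x *: f) c = x * f c. Proof. by []. Qed.
Lemma ps_sum (I : Type) (r : seq I) (P : pred I) (F : I -> ps) c :
  (\sum_(i <- r | P i) F i) c = \sum_(i <- r | P i) F i c.
Proof. by elim/big_rec2: _ => // i y1 y2 _ <-. Qed.

Definition monomial a : ps := fun c => (c == a)%:R.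

(* The sum runs over the finitely many factorizations of c. *)
Definition psmul f g : ps :=
  fun c => \sum_(p \in [set p : mono m * mono m | p.1 + p.2 = c]) f p.1 * g p.2.

Definition divisors_in c (E : seq (mono m)) :=
  uniq E /\ forall a b, a + b = c -> a \in E.

Lemma divisors_inP c : exists E, divisors_in c E.
Proof.
exists (fset_set [set a | exists b, a + b = c]); split; first exact: fset_uniq.
by move=> a b abc; rewrite in_fset_set ?inE /=; [exists b|exact: mono_divisors_finite].
Qed.

Lemma divisors_in_dvd c d E a : divisors_in d E -> c + a = d -> divisors_in c E.
Proof.
by move=> [uE EP] cad; split=> // x y xyc; apply: (EP x (y + a)); rewrite addrA xyc.
Qed.

Lemma psmulE f g c E : divisors_in c E ->
  psmul f g c = \sum_(a <- E) \sum_(b <- E | a + b == c) f a * g b.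
Proof.
move=> [uE EP]; rewrite /psmul (fsbigE [seq p <- allpairs pair E E | p.1 + p.2 == c]).
- rewrite big_mkcond big_filter big_mkcond big_allpairs_dep /=.
  apply: eq_bigr => a _; rewrite [RHS]big_mkcond; apply: eq_bigr => b _.
  by case: eqP => // e; rewrite ifT // inE.
- by apply: filter_uniq; apply: allpairs_uniq => // -[? ?] [? ?] _ _ [-> ->].
- by move=> [a b]; rewrite /= mem_filter => /andP[/eqP].
- move=> [a b] /= abc; rewrite mem_filter abc eqxx /= => /negP[].
  by apply/allpairsP; exists (a, b); split=> //; [exact: EP abc|
    apply: (EP _ a); rewrite addrC].
Qed.

Lemma psmulC : commutative psmul.
Proof.
move=> f g; apply/funext => c; have [E EP] := divisors_inP c.
rewrite !(psmulE _ _ EP) (exchange_big_dep xpredT) //=.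
apply: eq_bigr => a _; apply: eq_big => b; first by rewrite addrC.
by rewrite mulrC.
Qed.

Lemma psmulA : associative psmul.
Proof.
have mul3 f g h d E : divisors_in d E -> psmul (psmul f g) h d =
    \sum_(a <- E) \sum_(b <- E) \sum_(c <- E)
      if a + b + c == d then f a * g b * h c else 0.
  move=> EP; rewrite (psmulE _ _ EP).
  transitivity (\sum_(x <- E) \sum_(c <- E) \sum_(a <- E) \sum_(b <- E)
      if (x + c == d) && (x == a + b) then f a * g b * h c else 0).
    apply: eq_bigr => x _; rewrite big_mkcond; apply: eq_bigr => c _.
    case: eqP => [xcd|_]; last by rewrite big1 // => a _; rewrite big1.
    rewrite (psmulE _ _ (divisors_in_dvd EP xcd)) mulr_suml.
    apply: eq_bigr => a _; rewrite mulr_suml big_mkcond.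
    by apply: eq_bigr => b _; rewrite eq_sym.
  under eq_bigr => x _ do rewrite exchange_big /=.
  rewrite exchange_big; apply: eq_bigr => a _ /=.
  under eq_bigr => x _ do rewrite exchange_big /=.
  rewrite exchange_big; apply: eq_bigr => b _ /=.
  rewrite exchange_big; apply: eq_bigr => c _ /=.
  case: (eqVneq (a + b + c) d) => [abcd|abcd]; last first.
    by rewrite big1 // => x _; case: (eqVneq x (a + b)) => [->|];
      rewrite ?(negPf abcd) ?andbF.
  have abE : a + b \in E by case: EP => _; apply; exact: abcd.
  rewrite (bigD1_seq (a + b)) ?(proj1 EP) //= abcd !eqxx /= big1 ?addr0 // => x.
  by move=> /negPf->; rewrite andbF.
move=> f g h; apply/funext => d; have [E EP] := divisors_inP d.
rewrite [psmul f _]psmulC !(mul3 _ _ _ _ _ EP).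
under eq_bigr => a _ do rewrite exchange_big /=.
rewrite exchange_big /=; apply: eq_bigr => a _.
apply: eq_bigr => b _; apply: eq_bigr => c _.
by rewrite [b + c + a]addrC addrA; case: ifP => // _; rewrite [LHS]mulrC mulrA.
Qed.

Lemma psmul_monomial a f c :
  psmul (monomial a) f c = \sum_(b \in [set b | a + b = c]) f b.
Proof.
have [E EP] := divisors_inP c; rewrite (psmulE _ _ EP).
transitivity (\sum_(b <- E | a + b == c) f b); last first.
  rewrite -big_filter (fsbigE [seq b <- E | a + b == c]) ?filter_uniq ?(proj1 EP) //.
  - rewrite [RHS]big_seq_cond [LHS]big_seq_cond; apply: eq_bigl => b.
    apply/andP/andP => -[bE _]; split=> //; rewrite mem_set //=.
    by move: bE; rewrite mem_filter => /andP[/eqP].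
  - by move=> b; rewrite /= mem_filter => /andP[/eqP].
  - move=> b /= abc; rewrite mem_filter abc eqxx /= => /negP[].
    by case: EP => _; apply; rewrite addrC; exact: abc.
have [aE|aE] := boolP (a \in E); last first.
  rewrite big1_seq; last first.
    move=> x /andP[_ xE]; rewrite big1 // => b _; rewrite /monomial.
    by case: eqP => [xa|]; [rewrite -xa xE in aE|rewrite mul0r].
  rewrite big1 // => b /eqP abc.
  by case/negP: aE; case: EP => _; apply; exact: abc.
rewrite (bigD1_seq a) ?(proj1 EP) //= [X in _ + X]big1 ?addr0; last first.
  by move=> x /negPf xa; rewrite big1 // => b _; rewrite /monomial xa mul0r.
by apply: eq_bigr => b _; rewrite /monomial eqxx mul1r.
Qed.

Lemma psmul1 : left_id (monomial 0) psmul.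
Proof.
move=> f; apply/funext => c; rewrite psmul_monomial.
rewrite (_ : [set b | _] = [set c]) ?fsbig_set1 //.
by apply/seteqP; split=> b /=; rewrite add0r.
Qed.

Lemma psmulDl : left_distributive psmul psadd.
Proof.
move=> f g h; apply/funext => c; have [E EP] := divisors_inP c.
rewrite /psadd !(psmulE _ _ EP) -big_split; apply: eq_bigr => a _ /=.
by rewrite -big_split; apply: eq_bigr => b _; rewrite mulrDl.
Qed.

Lemma ps1_neq0 : monomial 0 != ps0.
Proof.
apply/eqP => /(congr1 (@^~ 0)); rewrite /monomial /ps0 eqxx; exact/eqP/oner_neq0.
Qed.

HB.instance Definition _ := GRing.Zmodule_isComNzRing.Build ps
  psmulA psmulC psmul1 psmulDl ps1_neq0.

Lemma psM f g : f * g = psmul f g. Proof. by []. Qed.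

Lemma psscaleAl x f g : x *: (f * g) = (x *: f) * g.
Proof.
apply/funext => c; have [E EP] := divisors_inP c.
rewrite psZ !psM !(psmulE _ _ EP) mulr_sumr.
by apply: eq_bigr => a _; rewrite mulr_sumr; apply: eq_bigr => b _; rewrite psZ mulrA.
Qed.

HB.instance Definition _ := GRing.Lmodule_isLalgebra.Build k ps psscaleAl.
HB.instance Definition _ := GRing.Lalgebra_isComAlgebra.Build k ps.

Lemma monomial0 : monomial 0 = 1 :> ps. Proof. by []. Qed.

Lemma monomialM a b : monomial a * monomial b = monomial (a + b) :> ps.
Proof.
apply/funext => c; rewrite [LHS]psmul_monomial /monomial.
case: (eqVneq c (a + b)) => [->|cab].
  rewrite -(@fsbig_widen _ _ _ _ [set b]) ?fsbig_set1 ?eqxx //.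
    by move=> x /= ->.
  by move=> x /= [_ /eqP/negPf->].
rewrite fsbig1 // => x /= axc; case: eqP => // xb.
by rewrite -axc xb eqxx in cab.
Qed.

Lemma monomial_prod (I : Type) (r : seq I) (P : pred I) (F : I -> mono m) :
  \prod_(i <- r | P i) monomial (F i) = monomial (\sum_(i <- r | P i) F i) :> ps.
Proof. by elim/big_rec2: _ => // i y1 y2 _ ->; rewrite monomialM. Qed.

End PowerSeries.

Section LinearSpan.
Variables (k : comNzRingType) (V : lmodType k).

Definition lspan (A : set V) : set V :=
  [set v | exists2 s : seq (k * V),
     (forall t, t \in s -> A t.2) & v = \sum_(t <- s) t.1 *: t.2].

Lemma lspan_gen A v : A v -> lspan A v.
Proof.
move=> Av; exists [:: (1, v)]; last by rewrite big_seq1 scale1r.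
by move=> t; rewrite inE => /eqP->.
Qed.

Lemma lspan0 A : lspan A 0.
Proof. by exists [::]; rewrite ?big_nil. Qed.

Lemma lspanD A u v : lspan A u -> lspan A v -> lspan A (u + v).
Proof.
move=> [s sA ->] [r rA ->]; exists (s ++ r); last by rewrite big_cat.
by move=> t; rewrite mem_cat => /orP[/sA|/rA].
Qed.

Lemma lspanZ A x v : lspan A v -> lspan A (x *: v).
Proof.
move=> [s sA ->]; exists [seq (x * t.1, t.2) | t <- s].
  by move=> _ /mapP[t /sA ts ->].
by rewrite big_map scaler_sumr; apply: eq_bigr => t _; rewrite scalerA.
Qed.

Lemma lspan_sum A (I : Type) (r : seq I) (P : pred I) (F : I -> V) :
  (forall i, P i -> lspan A (F i)) -> lspan A (\sum_(i <- r | P i) F i).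
Proof. by move=> AF; elim/big_ind: _; [exact: lspan0|exact: lspanD|]. Qed.

Lemma lspan_min (A B : set V) : A `<=` lspan B -> lspan A `<=` lspan B.
Proof.
move=> AB _ [s sA ->]; rewrite big_seq; apply: lspan_sum => t ts.
by apply: lspanZ; apply: AB; exact: sA.
Qed.

Lemma lspan_rangeP (I : eqType) (F : I -> V) v : lspan (range F) v ->
  exists s : seq (k * I), v = \sum_(t <- s) t.1 *: F t.2.
Proof.
move=> [s]; elim: s v => [|[x u] s IH] v sF ->; first by exists [::]; rewrite !big_nil.
have [i _ /= iu] := sF (x, u) (mem_head _ _).
have [t ts|r re] := IH _ _ erefl; first by apply: sF; rewrite inE ts orbT.
by exists ((x, i) :: r); rewrite !big_cons re -iu.
Qed.

End LinearSpan.

Lemma lspan_mul (k : comNzRingType) (R : comAlgType k) (A B C : set R) :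
  (forall a b, A a -> B b -> lspan C (a * b)) ->
  forall u v, lspan A u -> lspan B v -> lspan C (u * v).
Proof.
move=> ABC _ _ [s sA ->] [r rB ->].
rewrite mulr_suml big_seq; apply: lspan_sum => t /sA tA.
rewrite mulr_sumr big_seq; apply: lspan_sum => q /rB qB.
rewrite -scalerAl -scalerAr; apply: lspanZ; apply: lspanZ; exact: ABC.
Qed.

Section QuasiSymmetric.
Variables (k : comNzRingType) (m : nat).
Local Notation ps := (pseries k m).

Definition varmono (i : 'I_m) (j : nat) (e : Ntilde) : mono m :=
  [fsfun x in [fset (i, j)]%fset => e | 0].

(* x_{i,j}^e *)
Definition xpow (i : 'I_m) (j : nat) (e : Ntilde) : ps := monomial k (varmono i j e).

(* x_j^w when 0 < j, and x_{w,0} when j = 0 *)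
Definition xprod (j : nat) (w : wexp m) : ps := \prod_(i < m) xpow i j (val (w i)).

(* M_{(w_1, ..., w_n)}; the infinite sum is taken coefficientwise. *)
Definition Mqsym (ws : seq (wexp m)) : ps := fun c =>
  \sum_(js \in [set js : seq nat | size js = size ws /\ path ltn 0 js])
    (\prod_(p <- zip js ws) xprod p.1 p.2) c.

Definition WMQSym : set ps := lspan (range Mqsym).

(* k[X_0] *)
Definition polyX0 : set ps :=
  lspan (range (fun e : 'I_m -> nat => \prod_(i < m) xpow i 0 (Fin (e i)))).

Definition xeps0 : ps := xprod 0 (weps m).

Definition SMQSym_set : set ps :=
  lspan [set xeps0 * p * q | p in polyX0 & q in WMQSym].

Definition padd_subproof (x y : Ptilde) : val x + val y != 0.
Proof. by rewrite Ntilde_addr_eq0 negb_and (valP x). Qed.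

Definition padd (x y : Ptilde) : Ptilde :=
  exist (fun x : Ntilde => x != 0) (val x + val y) (padd_subproof x y).

Definition wadd (v w : wexp m) : wexp m := [ffun i => padd (v i) (w i)].

Definition colmono (j : nat) (w : wexp m) : mono m :=
  \sum_(i < m) varmono i j (val (w i)).

Definition seqmono (js : seq nat) (ws : seq (wexp m)) : mono m :=
  \sum_(p <- zip js ws) colmono p.1 p.2.

Lemma mono_sumE (I : Type) (r : seq I) (P : pred I) (F : I -> mono m) x :
  (\sum_(i <- r | P i) F i) x = \sum_(i <- r | P i) F i x.
Proof. by elim/big_rec2: _ => [|i y1 y2 _ <-]; rewrite ?monoE0 ?monoD. Qed.

Lemma colmonoE j w i j' : colmono j w (i, j') = if j' == j then val (w i) else 0.
Proof.
rewrite mono_sumE (bigD1 i) //= big1 => [|l li]; last first.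
  by rewrite fsfunE inE xpair_eqE eq_sym (negPf li).
by rewrite addr0 fsfunE inE xpair_eqE eqxx.
Qed.

Lemma xprodE j w : xprod j w = monomial k (colmono j w).
Proof. by rewrite /xprod /xpow monomial_prod. Qed.

Lemma xseqE js ws :
  \prod_(p <- zip js ws) xprod p.1 p.2 = monomial k (seqmono js ws).
Proof.
by rewrite /seqmono -monomial_prod; apply: eq_bigr => p _; rewrite xprodE.
Qed.

Lemma xpow0 i j : xpow i j 0 = 1.
Proof.
by congr (monomial k _); apply/fsfunP => x; rewrite monoE0 fsfunE; case: ifP.
Qed.

Lemma xpowM i j e e' : xpow i j e * xpow i j e' = xpow i j (e + e').
Proof.
rewrite monomialM; congr monomial; apply/fsfunP => x; rewrite monoD !fsfunE.
by case: ifP => _; rewrite ?addr0.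
Qed.

Lemma xprodM j v w : xprod j v * xprod j w = xprod j (wadd v w).
Proof. by rewrite -big_split; apply: eq_bigr => i _; rewrite /= xpowM ffunE. Qed.

Lemma waddeps : wadd (weps m) (weps m) = weps m.
Proof. by apply/ffunP => i; rewrite !ffunE; apply/val_inj. Qed.

Lemma xeps0M : xeps0 * xeps0 = xeps0.
Proof. by rewrite xprodM waddeps. Qed.

Fixpoint paths (j N n : nat) : seq (seq nat) :=
  if n is n'.+1 then [seq i :: t | i <- index_iota j.+1 N, t <- paths i N n']
  else [:: [::]].

Lemma mem_paths j N n js :
  (js \in paths j N n) = [&& size js == n, path ltn j js & all (ltn^~ N) js].
Proof.
elim: n j js => [|n IH] j [|i js] //=.
- by apply/negbTE/negP => /allpairsPdep[? [? [? ? /eqP]]].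
rewrite eqSS; apply/allpairsPdep/idP => [[i' [t [ii' tp [-> ->]]]]|].
  move: tp ii'; rewrite IH mem_index_iota => /and3P[-> -> ->] /andP[-> ->].
  by [].
case/and3P => sj /andP[ji pj] /andP[iN aN]; exists i, js; split=> //.
  by rewrite mem_index_iota ji.
by rewrite IH sj pj.
Qed.

Lemma paths_uniq j N n : uniq (paths j N n).
Proof.
elim: n j => //= n IH j; apply: allpairs_uniq_dep => //.
  exact: iota_uniq.
by move=> [? ?] [? ?] _ _ /= [-> ->].
Qed.

Fixpoint tM (j N : nat) (ws : seq (wexp m)) : ps :=
  if ws is w :: ws' then \sum_(j.+1 <= i < N) xprod i w * tM i N ws' else 1.

Lemma tME j N ws : tM j N ws = \sum_(js <- paths j N (size ws)) monomial k (seqmono js ws).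
Proof.
elim: ws j => [|w ws IH] j /=.
  by rewrite big_seq1 /seqmono big_nil.
rewrite big_allpairs_dep; apply: eq_bigr => i _; rewrite IH mulr_sumr.
by apply: eq_bigr => t _; rewrite /seqmono /= big_cons xprodE monomialM.
Qed.

Lemma tail_sumM (R : comNzRingType) (N : nat) (F G : nat -> R) j :
  let S H i := \sum_(i.+1 <= l < N) H l in
  S F j * S G j = S (fun i => F i * S G i) j + S (fun i => S F i * G i) j
                  + S (fun i => F i * G i) j.
Proof.
move=> S; have SE H i : (i.+1 < N)%N -> S H i = H i.+1 + S H i.+1.
  by move=> iN; rewrite /S big_ltn.
have S0 H i : (N <= i.+1)%N -> S H i = 0 by move=> Ni; rewrite /S big_geq.
move: {2}(N - j)%N (leqnn (N - j)) => n; elim: n j => [|n IH] j Njn.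
  by rewrite !S0 ?mul0r ?addr0 // ltnW // ltnS -subn_eq0 -leqn0.
have [jN|Nj] := ltnP j.+1 N; last by rewrite !S0 ?mul0r ?addr0.
have {}IH : _ := IH j.+1; rewrite !(SE _ _ jN) mulrDl !mulrDr IH.
  by rewrite /=; ring.
by rewrite subnS -subn1 leq_subLR add1n.
Qed.

Lemma tM_cons j N w ws :
  tM j N (w :: ws) = \sum_(j.+1 <= i < N) xprod i w * tM i N ws.
Proof. by []. Qed.

Lemma tM_mul u v :
  exists s, forall j N, tM j N u * tM j N v = \sum_(t <- s) tM j N t.
Proof.
move: {2}(size u + size v)%N (leqnn (size u + size v)) => n.
elim: n u v => [|n IH] [|a u] [|b v] //= uvn;
  try by [exists [:: [::]] => j N; rewrite big_seq1 mul1r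
         |exists [:: a :: u] => j N; rewrite big_seq1 mulr1
         |exists [:: b :: v] => j N; rewrite big_seq1 mul1r].
have [|s1 s1P] := IH u (b :: v); first by rewrite -ltnS /= -addSn.
have [|s2 s2P] := IH (a :: u) v; first by rewrite -ltnS /= -addnS.
have [|s3 s3P] := IH u v; first by rewrite ltnW // -ltnS -addSn -addnS.
exists (map (cons a) s1 ++ map (cons b) s2 ++ map (cons (wadd a b)) s3) => j N.
have consE c s : \sum_(t <- map (cons c) s) tM j N t =
    \sum_(j.+1 <= i < N) xprod i c * \sum_(t <- s) tM i N t.
  rewrite big_map; under eq_bigr => t _ do rewrite tM_cons.
  by rewrite exchange_big; apply: eq_bigr => i _; rewrite mulr_sumr.
rewrite big_cat big_cat; rewrite !consE.
have := tail_sumM N (fun i => xprod i a * tM i N u) (fun i => xprod i b * tM i N v) j.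
move=> /= ->; rewrite [RHS]addrA; congr (_ + _ + _); apply: eq_bigr => i _.
- by rewrite -tM_cons -mulrA s1P.
- by rewrite -tM_cons mulrCA s2P.
- by rewrite mulrACA s3P -xprodM.
Qed.

Definition bounded_mono (c : mono m) (N : nat) := forall i j, (N <= j)%N -> c (i, j) = 0.

Lemma bounded_monoP c : exists N, bounded_mono c N.
Proof.
exists (\max_(x <- finsupp c) x.2).+1 => i j jN; apply: fsfun_dflt.
apply/negP => ijc; move: jN; rewrite ltnNge => /negP[].
by rewrite (big_fsetD1 (i, j)) //= leq_maxl.
Qed.

Lemma bounded_monoD a b c N : bounded_mono c N -> a + b = c ->
  bounded_mono a N /\ bounded_mono b N.
Proof.
move=> cN abc; split=> i j /(cN i) /eqP;
  by rewrite -abc monoD Ntilde_addr_eq0 => /andP[/eqP ? /eqP ?].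
Qed.

Lemma seqmono_nil ws : seqmono [::] ws = 0.
Proof. by case: ws => [|w ws]; rewrite /seqmono big_nil. Qed.

Lemma seqmono_cons j js w ws :
  seqmono (j :: js) (w :: ws) = colmono j w + seqmono js ws.
Proof. by rewrite /seqmono big_cons. Qed.

Lemma seqmono_eq0 js ws i j : size js = size ws ->
  (seqmono js ws (i, j) == 0) = (j \notin js).
Proof.
elim: js ws => [|l js IH] [|w ws] //; first by rewrite seqmono_nil monoE0 eqxx.
move=> [sjs]; rewrite seqmono_cons monoD Ntilde_addr_eq0 IH // colmonoE inE negb_or.
by congr (_ && _); case: (j =P l) => // _; rewrite ?eqxx //; exact/negbTE/(valP (w i)).
Qed.

Hypothesis m_gt0 : (0 < m)%N.

Let i0 : 'I_m := Ordinal m_gt0.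

Lemma MqsymE ws c N : bounded_mono c N -> Mqsym ws c = tM 0 N ws c.
Proof.
move=> cN; rewrite /Mqsym tME ps_sum (fsbigE (paths 0 N (size ws))).
- rewrite big_seq_cond [RHS]big_seq_cond; apply: eq_big => [js|js _]; last by rewrite xseqE.
  rewrite andbT; case: (boolP (js \in _)) => //=; rewrite mem_paths.
  by move=> /and3P[/eqP sjs pjs _]; apply: mem_set.
- exact: paths_uniq.
- by move=> js /=; rewrite mem_paths => /and3P[/eqP sjs pjs _].
- move=> js /= [sjs pjs]; rewrite mem_paths sjs eqxx pjs /= xseqE /monomial.
  move=> /allPn[j jjs]; rewrite -leqNgt => Nj; case: eqP => // cE.
  move: (cN i0 _ Nj) => /eqP; rewrite cE seqmono_eq0 //.
  by rewrite jjs.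
Qed.

Lemma Mqsym_mul_gt0 u v : WMQSym (Mqsym u * Mqsym v).
Proof.
have [s sP] := tM_mul u v.
suff -> : Mqsym u * Mqsym v = \sum_(t <- s) Mqsym t.
  by apply: lspan_sum => t _; apply: lspan_gen; exists t.
apply/funext => c; have [N cN] := bounded_monoP c; have [E EP] := divisors_inP c.
rewrite ps_sum psM (psmulE _ _ EP).
transitivity ((tM 0 N u * tM 0 N v) c).
  rewrite psM (psmulE _ _ EP); apply: eq_bigr => a _; apply: eq_bigr => b /eqP abc.
  by have [aN bN] := bounded_monoD cN abc; rewrite !(MqsymE _ (N := N)).
by rewrite sP ps_sum; apply: eq_bigr => t _; rewrite (MqsymE _ cN).
Qed.

Lemma seqmonoE js ws w0 i j : size js = size ws -> uniq js ->
  seqmono js ws (i, j) =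
  if j \in js then val (nth w0 ws (index j js) i) else 0.
Proof.
elim: js ws => [|l js IH] [|w ws] //; first by rewrite seqmono_nil monoE0.
move=> [sjs] /= /andP[ljs ujs]; rewrite seqmono_cons monoD colmonoE IH // inE eq_sym.
have [<-|_] := eqVneq l j; first by rewrite (negPf ljs) addr0.
by rewrite add0r.
Qed.

Lemma lead_inj w v js ks ws vs :
    size js = size ws -> size ks = size vs -> path ltn 0 js -> path ltn 0 ks ->
    colmono 0 w + seqmono js ws = colmono 0 v + seqmono ks vs ->
  [/\ w = v, js = ks & ws = vs].
Proof.
move=> sjs sks pjs pks e.
have pos ls : path ltn 0 ls -> forall j, j \in ls -> (0 < j)%N.
  by move=> /(order_path_min ltn_trans)/allP.
have no0 ls : path ltn 0 ls -> 0%N \notin ls.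
  by move=> /pos p; apply/negP => /p.
have srt ls : path ltn 0 ls -> sorted ltn ls by exact: path_sorted.
have unq ls : path ltn 0 ls -> uniq ls.
  by move=> /srt; apply: sorted_uniq; [exact: ltn_trans|exact: ltnn].
have ev i j : (colmono 0 w + seqmono js ws) (i, j) =
              (colmono 0 v + seqmono ks vs) (i, j) by rewrite e.
have wv : w = v.
  apply/ffunP => i; apply/val_inj; move: (ev i 0%N).
  rewrite !monoD !colmonoE /=; move/eqP: (seqmono_eq0 i 0 sjs) => _.
  have /eqP-> : seqmono js ws (i, 0%N) == 0 by rewrite seqmono_eq0 // no0.
  have /eqP-> : seqmono ks vs (i, 0%N) == 0 by rewrite seqmono_eq0 // no0.
  by rewrite !addr0.
have ev' i j : (0 < j)%N -> seqmono js ws (i, j) = seqmono ks vs (i, j).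
  by move=> j0; move: (ev i j); rewrite !monoD !colmonoE gtn_eqF // !add0r.
have jk : js = ks.
  apply: (irr_sorted_eq ltn_trans ltnn (srt _ pjs) (srt _ pks)) => j.
  have [->|j0] := posnP j; first by rewrite !(negPf (no0 _ _)).
  by apply: negb_inj; rewrite -(seqmono_eq0 i0 _ sjs) -(seqmono_eq0 i0 _ sks) ev'.
split=> //; subst ks; apply: (@eq_from_nth _ w) => [|n nws]; first by rewrite -sjs.
apply/ffunP => i; apply/val_inj.
have njs : (n < size js)%N by rewrite sjs.
have := ev' i (nth 0%N js n) (pos _ pjs _ (mem_nth _ njs)).
by rewrite !(seqmonoE w) ?unq // mem_nth // index_uniq ?unq.
Qed.

Definition lead (b : wexp m * seq (wexp m)) : mono m :=
  colmono 0 b.1 + seqmono (iota 1 (size b.2)) b.2.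

Lemma lead_coef_Mbar b b' : (xprod 0 b'.1 * Mqsym b'.2) (lead b) = (b == b')%:R.
Proof.
have [N bN] := bounded_monoP (lead b); have [E EP] := divisors_inP (lead b).
transitivity ((xprod 0 b'.1 * tM 0 N b'.2) (lead b)).
  rewrite !psM !(psmulE _ _ EP); apply: eq_bigr => a _; apply: eq_bigr => c /eqP acb.
  by have [_ cN] := bounded_monoD bN acb; rewrite (MqsymE _ cN).
rewrite xprodE tME mulr_sumr ps_sum.
under eq_bigr => js _ do rewrite monomialM.
have iota_path n : path ltn 0 (iota 1 n).
  by rewrite (_ : path _ _ _ = sorted ltn (iota 0 n.+1)) //; exact: iota_ltn_sorted.
have [<-|bb'] := eqVneq b b'; last first.
  rewrite big1_seq // => js /=; rewrite mem_paths => /and3P[/eqP sjs pjs _].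
  rewrite /monomial; case: eqP => // /lead_inj[]; rewrite ?size_iota // => e1 _ e2.
  by case/eqP: bb'; case: b b' e1 e2 {bN EP sjs} => [? ?] [? ?] /= -> ->.
have jsin : iota 1 (size b.2) \in paths 0 N (size b.2).
  rewrite mem_paths size_iota eqxx iota_path /=; apply/allP => j jin.
  rewrite ltnNge; apply/negP => Nj; move/eqP: (bN i0 _ Nj).
  by rewrite /lead monoD Ntilde_addr_eq0 seqmono_eq0 ?size_iota // jin andbF.
rewrite (bigD1_seq _ jsin) ?paths_uniq //= /monomial eqxx big1_seq ?addr0 //.
move=> js /andP[jsn]; rewrite mem_paths => /and3P[/eqP sjs pjs _].
case: eqP => // /lead_inj[]; rewrite ?size_iota // => _ e _.
by rewrite e eqxx in jsn.
Qed.

End QuasiSymmetric.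

Arguments xeps0 : clear implicits.

Section SMQSymAlgebra.
Variables (k : comNzRingType) (m : nat).
Local Notation ps := (pseries k m).
Local Notation wexp := (wexp m).

Lemma Mqsym_nil : Mqsym k [::] = 1 :> ps.
Proof.
apply/funext => c; rewrite /Mqsym (_ : [set js | _] = [set [::]]).
  by rewrite fsbig_set1 big_nil.
apply/seteqP; split=> [js /= [/eqP]|js /= ->]; last by [].
by rewrite size_eq0 => /eqP.
Qed.

Lemma WMQSymM f g : WMQSym f -> WMQSym g -> WMQSym (f * g : ps).
Proof.
apply: lspan_mul => _ _ [u _ <-] [v _ <-].
have [m0|m_gt0] := posnP m; last exact: Mqsym_mul_gt0.
have -> : Mqsym k u * Mqsym k v = (Mqsym k u * Mqsym k v) 0 *: 1 :> ps.
  apply/funext => c; rewrite psZ -monomial0 /monomial.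
  have -> : c = 0 by apply/fsfunP => -[[i /= im]]; exfalso; rewrite m0 in im.
  by rewrite eqxx mulr1.
by apply: lspanZ; apply: lspan_gen; exists [::] => //; rewrite Mqsym_nil.
Qed.

Lemma polyX0M f g : polyX0 f -> polyX0 g -> polyX0 (f * g : ps).
Proof.
apply: lspan_mul => _ _ [u _ <-] [v _ <-]; apply: lspan_gen.
exists (fun i => (u i + v i)%N) => //.
rewrite -big_split; apply: eq_bigr => i _ /=.
by rewrite xpowM FinD.
Qed.

Lemma SMQSym_setM f g : SMQSym_set f -> SMQSym_set g -> SMQSym_set (f * g : ps).
Proof.
apply: lspan_mul => _ _ [p pX [q qW <-]] [p' pX' [q' qW' <-]]; apply: lspan_gen.
exists (p * p'); first exact: polyX0M.
exists (q * q'); first exact: WMQSymM.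
by rewrite -[X in X * _ * _](xeps0M k m); ring.
Qed.

Lemma SMQSym_set1 : SMQSym_set (xeps0 k m).
Proof.
apply: lspan_gen; exists 1.
  apply: lspan_gen; exists (fun=> 0%N); first by [].
  by apply: big1 => i _; exact: xpow0.
exists 1; last by rewrite !mulr1.
by apply: lspan_gen; exists [::] => //; rewrite Mqsym_nil.
Qed.

Lemma SMQSym_setMbar (w : wexp) ws : SMQSym_set (xprod k 0 w * Mqsym k ws).
Proof.
apply: lspan_gen; exists (\prod_(i < m) xpow k i 0 (Fin (nat_of_Ntilde (val (w i))))).
  by apply: lspan_gen; exists (fun i => nat_of_Ntilde (val (w i))).
exists (Mqsym k ws); first by apply: lspan_gen; exists ws.
congr (_ * _); rewrite -big_split; apply: eq_bigr => i _; rewrite /= xpowM ffunE.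
by congr xpow; case: (w i) => -[[|n]|].
Qed.

Lemma SMQSym_setE : @SMQSym_set k m =
  lspan (range (fun b : wexp * seq wexp => xprod k 0 b.1 * Mqsym k b.2)).
Proof.
apply/seteqP; split; apply: lspan_min; last first.
  by move=> _ [b _ <-]; exact: SMQSym_setMbar.
move=> _ [p pX [q qW <-]].
pose B := range (fun e : 'I_m -> nat => xeps0 k m * \prod_(i < m) xpow k i 0 (Fin (e i))).
have xpB : lspan B (xeps0 k m * p).
  apply: (lspan_mul _ (lspan_gen (erefl : [set xeps0 k m] (xeps0 k m))) pX).
  by move=> _ _ -> [e _ <-]; apply: lspan_gen; exists e.
apply: (lspan_mul _ xpB qW) => _ _ [e _ <-] [ws _ <-]; apply: lspan_gen.
have pos i : Eps + Fin (e i) != 0 by case: (e i).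
pose w : wexp := [ffun i => exist (fun x : Ntilde => x != 0) _ (pos i)].
exists (w, ws) => //=; congr (_ * _); rewrite -big_split; apply: eq_bigr => i _ /=.
by rewrite xpowM !ffunE.
Qed.

Lemma xeps0_SMQSym f : SMQSym_set f -> xeps0 k m * f = f.
Proof.
move=> [s sX ->]; rewrite mulr_sumr; apply: eq_big_seq => t /sX [p _ [q _ <-]].
by rewrite -scalerAr !mulrA xeps0M.
Qed.

Lemma xeps0_neq0 : xeps0 k m != 0.
Proof.
rewrite /xeps0 xprodE; apply/eqP => /(congr1 (@^~ (colmono 0 (weps m)))).
by rewrite /monomial eqxx psE0; exact/eqP/oner_neq0.
Qed.

Definition SMQSym_pred : {pred ps} := fun f => `[< SMQSym_set f >].

Lemma SMQSym_submod_closed : submod_closed SMQSym_pred.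
Proof.
split=> [|x f g /asboolP fS /asboolP gS]; apply/asboolP; first exact: lspan0.
by apply: lspanD => //; exact: lspanZ.
Qed.

HB.instance Definition _ :=
  GRing.isSubmodClosed.Build k ps SMQSym_pred SMQSym_submod_closed.

Record SMQSym := { SMQSym_val : ps; SMQSym_valP : SMQSym_val \in SMQSym_pred }.

HB.instance Definition _ := [isSub for SMQSym_val].
HB.instance Definition _ := [Choice of SMQSym by <:].
HB.instance Definition _ := [SubChoice_isSubLmodule of SMQSym by <:].

Definition inSMQSym f (fS : SMQSym_set f) : SMQSym :=
  Build_SMQSym (introT (asboolP _) fS).

Lemma SMQSymP (f : SMQSym) : SMQSym_set (val f).
Proof. by case: f => f fS; apply/asboolP. Qed.

(* SMQSym is not a unital subring of k[[\bar X]]^{\tilde N}: its product is the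
   restricted one, but its identity is x_{[m]^eps, 0}. *)
Definition SMQSym_mul (f g : SMQSym) : SMQSym :=
  inSMQSym (SMQSym_setM (SMQSymP f) (SMQSymP g)).

Definition SMQSym_one : SMQSym := inSMQSym SMQSym_set1.

Lemma SMQSym_mulA : associative SMQSym_mul.
Proof. by move=> f g h; apply/val_inj/mulrA. Qed.
Lemma SMQSym_mulC : commutative SMQSym_mul.
Proof. by move=> f g; apply/val_inj/mulrC. Qed.
Lemma SMQSym_mul1 : left_id SMQSym_one SMQSym_mul.
Proof. by move=> f; apply/val_inj/xeps0_SMQSym/SMQSymP. Qed.
Lemma SMQSym_mulDl : left_distributive SMQSym_mul +%R.
Proof. by move=> f g h; apply/val_inj/mulrDl. Qed.
Lemma SMQSym_one_neq0 : SMQSym_one != 0.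
Proof. by rewrite -val_eqE; exact: xeps0_neq0. Qed.

HB.instance Definition _ := GRing.Zmodule_isComNzRing.Build SMQSym
  SMQSym_mulA SMQSym_mulC SMQSym_mul1 SMQSym_mulDl SMQSym_one_neq0.

Lemma SMQSym_scaleAl x (f g : SMQSym) : x *: (f * g) = (x *: f) * g.
Proof. by apply/val_inj/scalerAl. Qed.

HB.instance Definition _ := GRing.Lmodule_isLalgebra.Build k SMQSym SMQSym_scaleAl.
HB.instance Definition _ := GRing.Lalgebra_isComAlgebra.Build k SMQSym.

Lemma SMQSym_valM (f g : SMQSym) : val (f * g) = val f * val g.
Proof. by []. Qed.

Lemma SMQSym_val1 : val (1 : SMQSym) = xeps0 k m.
Proof. by []. Qed.

(* \overline M_{(w, w_1, ..., w_n)} = x_{w,0} M_{(w_1, ..., w_n)} *)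
Definition Mbar (w : wexp) (ws : seq wexp) : SMQSym :=
  inSMQSym (SMQSym_setMbar w ws).

Lemma SMQSym_span (f : SMQSym) :
  exists s : seq (k * (wexp * seq wexp)), f = \sum_(t <- s) t.1 *: Mbar t.2.1 t.2.2.
Proof.
have := SMQSymP f; rewrite SMQSym_setE => /lspan_rangeP[s sE]; exists s.
by apply/val_inj; rewrite sE raddf_sum.
Qed.

Lemma Mbar_linear_ext (V : lmodType k) (g : wexp -> seq wexp -> V) : (0 < m)%N ->
  exists phi : SMQSym -> V, linear phi /\ forall w ws, phi (Mbar w ws) = g w ws.
Proof.
move=> m_gt0; pose lin (s : seq (k * (wexp * seq wexp))) (W : lmodType k)
    (h : wexp -> seq wexp -> W) := \sum_(t <- s) t.1 *: h t.2.1 t.2.2.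
have lin0 s : lin s SMQSym Mbar = 0 -> lin s V g = 0.
  move=> s0; have partE (W : lmodType k) h : lin s W h =
      \sum_(b <- undup (map snd s)) (\sum_(t <- s | t.2 == b) t.1) *: h b.1 b.2.
    transitivity (\sum_(b <- undup (map snd s)) \sum_(t <- s | t.2 == b)
        t.1 *: h t.2.1 t.2.2); last first.
      apply: eq_bigr => b _; rewrite scaler_suml.
      by apply: eq_bigr => t /eqP->.
    rewrite (exchange_big_dep xpredT) //=; apply: eq_big_seq => t ts.
    under eq_bigl => b do rewrite eq_sym.
    rewrite -big_filter filter_pred1_uniq ?undup_uniq ?big_seq1 //.
    by rewrite mem_undup; apply: map_f.
  rewrite partE big1_seq // => b /= _.
  suff -> : \sum_(t <- s | t.2 == b) t.1 = val (lin s SMQSym Mbar) (lead b).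
    by rewrite s0 scale0r.
  rewrite raddf_sum ps_sum big_mkcond; apply: eq_bigr => t _.
  rewrite /= psZ lead_coef_Mbar // eq_sym.
  by case: eqP => _; rewrite ?mulr1 ?mulr0.
pose s_of f := sval (cid (SMQSym_span f)).
have s_ofP f : f = lin (s_of f) SMQSym Mbar by exact: svalP (cid (SMQSym_span f)).
have linD x s r (W : lmodType k) h :
    lin ([seq (x * t.1, t.2) | t <- s] ++ r) W h = x *: lin s W h + lin r W h.
  rewrite /lin big_cat big_map scaler_sumr; congr (_ + _).
  by apply: eq_bigr => t _; rewrite scalerA.
have lin_eq s r : lin s SMQSym Mbar = lin r SMQSym Mbar -> lin s V g = lin r V g.
  move=> e; apply/eqP; rewrite eq_sym -subr_eq0 addrC -scaleN1r -linD; apply/eqP/lin0.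
  by rewrite linD e scaleN1r addNr.
exists (fun f => lin (s_of f) V g); split=> [x f h|w ws].
  by rewrite -linD; apply: lin_eq; rewrite linD -!s_ofP.
rewrite (lin_eq _ [:: (1, (w, ws))]) -?s_ofP /lin big_seq1 scale1r //.
Qed.

(* For 0 < m the set is a singleton: it is nonempty by [SMQSym_RBopP], and a
   linear map is determined by its values on the Mbar by [SMQSym_span]; the
   default value idfun is then irrelevant. *)
Definition SMQSym_RBop : SMQSym -> SMQSym :=
  xget (idfun : SMQSym -> SMQSym) [set P : SMQSym -> SMQSym | linear P /\
    forall w ws, P (Mbar w ws) = Mbar (weps m) (w :: ws)].

Lemma SMQSym_RBopP : (0 < m)%N -> linear SMQSym_RBop /\
  forall w ws, SMQSym_RBop (Mbar w ws) = Mbar (weps m) (w :: ws).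
Proof.
move=> m_gt0; rewrite /SMQSym_RBop; case: xgetP => [P _ //|noP].
have [P PP] := Mbar_linear_ext (fun w ws => Mbar (weps m) (w :: ws)) m_gt0.
by case: (noP P).
Qed.

Lemma SMQSym_gen_subproof (i : 'I_m) :
  SMQSym_set (\prod_(l < m) xpow k l 0 (if l == i then Fin 1 else Eps)).
Proof.
pose w : wexp := [ffun l => if l == i then pone else peps].
suff -> : \prod_(l < m) xpow k l 0 (if l == i then Fin 1 else Eps) =
          xprod k 0 w * Mqsym k [::] by exact: SMQSym_setMbar.
rewrite Mqsym_nil mulr1; apply: eq_bigr => l _.
by rewrite ffunE; case: ifP.
Qed.

Definition SMQSym_gen (i : 'I_m) : SMQSym := inSMQSym (SMQSym_gen_subproof i).

End SMQSymAlgebra.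

Section RotaBaxter.
Variables (k : comNzRingType) (lambda : k).

Definition rota_baxter (R : algType k) (P : R -> R) :=
  linear P /\
  forall x y, P x * P y = P (x * P y) + P (P x * y) + lambda *: P (x * y).

Definition rota_baxter_morphism (R S : algType k) (P : R -> R) (Q : S -> S)
    (phi : R -> S) :=
  [/\ linear phi, monoid_morphism phi & forall x, phi (P x) = Q (phi x)].

(* The types R : comAlgType k are the nonzero commutative k-algebras; for the
   zero algebra the universal property holds trivially, since there is exactly
   one map into it. *)
Definition free_com_rota_baxter (Y : Type) (F : comAlgType k) (P : F -> F)
    (j : Y -> F) :=
  rota_baxter P /\
  forall (R : comAlgType k) (Q : R -> R), rota_baxter Q ->
  forall f : Y -> R,
  exists! phi : F -> R, rota_baxter_morphism P Q phi /\ phi \o j = f.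

End RotaBaxter.

(* Main.v *)
(* The basis elements multiply by Mbar w u * Mbar w' v = \sum_t Mbar (w + w') t,
   with t ranging over the quasi-shuffles of u and v.  The recursion defining
   quasi-shuffles is the Rota-Baxter identity of weight 1: it holds for the
   iterated images h (a :: u) = Q (c a * h u) in every commutative Rota-Baxter
   algebra, and it makes P a Rota-Baxter operator.  Since Mbar w u is the
   product of a monomial in the generators by Mbar eps u, and Mbar eps (a :: u) is
   P (Mbar a u), a morphism is determined by, and can be prescribed on, the
   generators. *)
Require Import Defs.
From HB Require Import structures.
From mathcomp Require Import all_boot all_order all_algebra.
From mathcomp Require Import boolp.

Import GRing.Theory.
Local Open Scope ring_scope.

Set Implicit Arguments.
Unset Strict Implicit.
Unset Printing Implicit Defensive.

(** * Quasi-shuffles of words *)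

(** The nested fixpoint makes the recursion structural, since either word may be the one that
    shrinks. The result is a list because quasi-shuffles count with multiplicity. *)
Fixpoint qshuffle (T : Type) (add : T -> T -> T) (u : seq T) : seq T -> seq (seq T) :=
  if u is a :: u' then
    fix qshuffle_u v :=
      if v is b :: v' then
        map (cons a) (qshuffle add u' v) ++ map (cons b) (qshuffle_u v') ++
        map (cons (add a b)) (qshuffle add u' v')
      else [:: u]
  else fun v => [:: v].

Section QuasiShuffle.
Variables (T : Type) (add : T -> T -> T).

Lemma qshuffle_cons a u b v :
  qshuffle add (a :: u) (b :: v) =
    map (cons a) (qshuffle add u (b :: v)) ++
    map (cons b) (qshuffle add (a :: u) v) ++
    map (cons (add a b)) (qshuffle add u v).
Proof. by []. Qed.

Lemma big_qshuffle_cons (V : nmodType) (F : seq T -> V) a u b v :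
  \sum_(t <- qshuffle add (a :: u) (b :: v)) F t =
    \sum_(t <- qshuffle add u (b :: v)) F (a :: t) +
    \sum_(t <- qshuffle add (a :: u) v) F (b :: t) +
    \sum_(t <- qshuffle add u v) F (add a b :: t).
Proof. by rewrite qshuffle_cons !big_cat !big_map /= addrA. Qed.

End QuasiShuffle.

Lemma linear_big_sum (k : pzRingType) (U V : lmodType k) (f : U -> V) :
  linear f -> forall (I : Type) (r : seq I) (F : I -> U),
  f (\sum_(i <- r) F i) = \sum_(i <- r) f (F i).
Proof.
move=> lin I r F.
pose g : {linear U -> V} := HB.pack f (GRing.isLinear.Build _ _ _ _ f lin).
exact: (raddf_sum g).
Qed.

(** * Iterated images under a Rota-Baxter operator *)

Section IteratedRotaBaxter.
Variables (k : comNzRingType) (R : comAlgType k) (Q : R -> R).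
Hypothesis Q_rb : rota_baxter 1 Q.
Variables (T : Type) (add : T -> T -> T) (c : T -> R).
Hypothesis cM : forall a b, c (add a b) = c a * c b.

Fixpoint rb_iter (u : seq T) : R := if u is a :: u' then Q (c a * rb_iter u') else 1.

Lemma rb_iterM u v :
  rb_iter u * rb_iter v = \sum_(t <- qshuffle add u v) rb_iter t.
Proof.
have [Qlin QM] := Q_rb.
elim: u v => [|a u IHu] v; first by rewrite big_seq1 mul1r.
elim: v => [|b v IHv]; first by rewrite big_seq1 mulr1.
have consE d s : \sum_(t <- s) rb_iter (d :: t) = Q (c d * \sum_(t <- s) rb_iter t).
  by rewrite mulr_sumr linear_big_sum.
(* [IHu] serves twice: for [u] against [b :: v] and for [u] against [v]. *)
rewrite big_qshuffle_cons !consE -IHu -IHv -IHu [LHS]QM scale1r cM.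
congr (Q _ + Q _ + Q _); first by rewrite mulrA.
  by rewrite mulrCA.
by rewrite mulrACA.
Qed.

End IteratedRotaBaxter.

(** * Products of basis elements and the operator *)

Section SMQSymFree.
Variables (k : comNzRingType) (m : nat).
Hypothesis m_gt0 : (0 < m)%N.
Local Notation P := (@SMQSym_RBop k m).
Local Notation wexp := (wexp m).
Implicit Types (w : wexp) (u v : seq wexp).

(** The product of two sums over increasing indices splits by whether the first index of the left
    factor is smaller than, larger than or equal to that of the right one. The bound [j] varies
    because the tails start at that index. *)
Lemma tM_qshuffle N u v j :
  tM k j N u * tM k j N v = \sum_(t <- qshuffle (@wadd m) u v) tM k j N t.
Proof.
elim: u v j => [|a u IHu] v j; first by rewrite big_seq1 mul1r.
elim: v j => [|b v IHv] j; first by rewrite big_seq1 mulr1.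
have consE d s : \sum_(t <- s) tM k j N (d :: t) =
    \sum_(j.+1 <= i < N) xprod k i d * \sum_(t <- s) tM k i N t.
  under eq_bigr => t _ do rewrite tM_cons.
  by rewrite exchange_big; apply: eq_bigr => i _; rewrite mulr_sumr.
rewrite big_qshuffle_cons; apply: eq_trans.
  exact: (tail_sumM N (fun i => xprod k i a * tM k i N u)
                      (fun i => xprod k i b * tM k i N v) j).
congr (_ + _ + _); rewrite [RHS]consE; apply: eq_bigr => i _.
- by rewrite -tM_cons -mulrA IHu.
- by rewrite -tM_cons mulrCA IHv.
- by rewrite mulrACA IHu -xprodM.
Qed.

(** A monomial [c] and all its divisors involve only columns below some [N], so at [c] each series
    may be replaced by its finite truncation [tM]. *)
Lemma MqsymM u v :
  Mqsym k u * Mqsym k v = \sum_(t <- qshuffle (@wadd m) u v) Mqsym k t.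
Proof.
apply/funext => c; have [N cN] := bounded_monoP c; have [E EP] := divisors_inP c.
rewrite ps_sum psM (psmulE _ _ EP).
transitivity ((tM k 0 N u * tM k 0 N v) c).
  rewrite psM (psmulE _ _ EP); apply: eq_bigr => a _; apply: eq_bigr => b /eqP abc.
  by have [aN bN] := bounded_monoD cN abc; rewrite !(MqsymE k m_gt0 _ (N := N)).
by rewrite tM_qshuffle ps_sum; apply: eq_bigr => t _; rewrite (MqsymE k m_gt0 _ cN).
Qed.

Lemma MbarM w w' u v :
  Mbar k w u * Mbar k w' v =
  \sum_(t <- qshuffle (@wadd m) u v) Mbar k (wadd w w') t.
Proof.
apply/val_inj; rewrite raddf_sum.
transitivity (xprod k 0 w * Mqsym k u * (xprod k 0 w' * Mqsym k v)); first by [].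
by rewrite mulrACA xprodM MqsymM mulr_sumr; apply: eq_bigr.
Qed.

Lemma wadd_eps_r w : wadd w (weps m) = w.
Proof.
by apply/ffunP => i; apply/val_inj; rewrite !ffunE /=; case: (w i) => [[[|n]|]].
Qed.

Lemma wadd_eps_l w : wadd (weps m) w = w.
Proof.
by apply/ffunP => i; apply/val_inj; rewrite !ffunE /=; case: (w i) => [[[|n]|]].
Qed.

Lemma SMQSym1E : 1 = Mbar k (weps m) [::].
Proof. by apply/val_inj; rewrite SMQSym_val1 /= Mqsym_nil mulr1. Qed.

Lemma Mbar_split w u : Mbar k w u = Mbar k w [::] * Mbar k (weps m) u.
Proof. by rewrite MbarM big_seq1 wadd_eps_r. Qed.

Lemma SMQSym_linear_eq (V : lmodType k) (f g : SMQSym k m -> V) :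
  linear f -> linear g -> (forall w u, f (Mbar k w u) = g (Mbar k w u)) ->
  forall x, f x = g x.
Proof.
move=> flin glin fg x; have [s ->] := SMQSym_span x.
rewrite (linear_big_sum flin) (linear_big_sum glin); apply: eq_bigr => t _.
(* Adding 0 gives the term the shape [a *: u + v] of [linear]; the values at 0 then come from empty
   sums. *)
rewrite -[_ *: _]addr0 flin glin fg; congr (_ + _).
by have /= := linear_big_sum flin [::] idfun; have /= := linear_big_sum glin [::] idfun;
  rewrite !big_nil => -> ->.
Qed.

Lemma SMQSym_RBop_linear : linear P.
Proof. by have [] := SMQSym_RBopP k m_gt0. Qed.

Lemma SMQSym_RBopE w u : P (Mbar k w u) = Mbar k (weps m) (w :: u).
Proof. by have [_ ->] := SMQSym_RBopP k m_gt0. Qed.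

(** Both sides are linear in each variable, so basis elements suffice. There the three terms collect
    the quasi-shuffles of [w :: u] and [w' :: v] beginning with [w], [w'] and [wadd w w']. *)
Lemma SMQSym_RBop_rota_baxter : rota_baxter 1 P.
Proof.
have Plin := SMQSym_RBop_linear; split=> // x y.
move: y; apply: SMQSym_linear_eq => [r f g|r f g|w' v].
- by rewrite Plin mulrDr scalerAr.
- rewrite !(Plin, mulrDr) -!scalerAr !Plin !scale1r !scalerDr.
  by rewrite [X in X + _ = _]addrACA [LHS]addrACA.
move: x; apply: SMQSym_linear_eq => [r f g|r f g|w u].
- by rewrite Plin mulrDl scalerAl.
- rewrite !(Plin, mulrDl) -!scalerAl !Plin !scale1r !scalerDr.
  by rewrite [X in X + _ = _]addrACA [LHS]addrACA.
rewrite !SMQSym_RBopE !MbarM waddeps big_qshuffle_cons wadd_eps_r wadd_eps_l scale1r.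
by rewrite !(linear_big_sum Plin); congr (_ + _ + _);
  apply: eq_bigr => t _; rewrite SMQSym_RBopE.
Qed.

(** The monomial [lead b] occurs in the basis element of [b] and in no other. *)
Lemma Mbar_inj : injective (fun b : wexp * seq wexp => Mbar k b.1 b.2).
Proof.
have coefE (b b' : wexp * seq wexp) : val (Mbar k b'.1 b'.2) (lead b) = (b == b')%:R.
  exact: (lead_coef_Mbar k m_gt0).
move=> b b' /(congr1 (fun f => val f (lead b))); rewrite !coefE eqxx.
by case: (b =P b') => // _ /eqP; rewrite oner_eq0.
Qed.

(** * Generators and the monomials in them *)

Definition wgen i : wexp := [ffun l => if l == i then pone else peps].

Lemma SMQSym_genE i : SMQSym_gen k i = Mbar k (wgen i) [::].
Proof.
apply/val_inj; rewrite /= Mqsym_nil mulr1; apply: eq_bigr => l _.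
by rewrite ffunE; case: ifP.
Qed.

Lemma SMQSym_genX_Mbar i n w :
  (SMQSym_gen k i) ^+ n * Mbar k w [::] =
  Mbar k (iter n (wadd (wgen i)) w) [::].
Proof.
elim: n => [|n IH]; first by rewrite mul1r.
by rewrite exprS -mulrA IH SMQSym_genE MbarM big_seq1.
Qed.

Lemma wadd_gen_iter i n w l :
  nat_of_Ntilde (val (iter n (wadd (wgen i)) w l)) =
  (n * (l == i) + nat_of_Ntilde (val (w l)))%N.
Proof.
elim: n => [//|n IH].
rewrite iterS ffunE /= nat_of_NtildeD IH ffunE mulSn addnA.
by case: (l == i).
Qed.

(** Since [Fin 0] is excluded, [Eps] alone is read as 0; exponents in [Ptilde] thus behave as
    natural numbers with [Eps] as zero. *)
Lemma Ptilde_nat_inj : injective (fun p : Ptilde => nat_of_Ntilde (val p)).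
Proof. by move=> [[[|n]|] hn] [[[|p]|] hp] //= e; apply/val_inj => //=; rewrite e. Qed.

Lemma MbarE w : Mbar k w [::] = \prod_(i < m) SMQSym_gen k i ^+ nat_of_Ntilde (val (w i)).
Proof.
(* Variables are treated one at a time; those outside [r] keep exponent [peps], as in the identity
   element. *)
suff prodE (r : seq 'I_m) : uniq r ->
    \prod_(i <- r) SMQSym_gen k i ^+ nat_of_Ntilde (val (w i)) =
    Mbar k ([ffun i => if i \in r then w i else peps] : wexp) [::].
  rewrite [RHS](prodE _ (index_enum_uniq _)).
  apply: (congr1 (fun w => Mbar k w [::])).
  by apply/ffunP => i; rewrite ffunE mem_index_enum.
elim: r => [_|i r IH /= /andP[/negPf ir /IH {}IH]].
  rewrite big_nil SMQSym1E; apply: (congr1 (fun w => Mbar k w [::])).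
  by apply/ffunP => i; rewrite !ffunE.
rewrite big_cons IH SMQSym_genX_Mbar; apply: (congr1 (fun w => Mbar k w [::])).
apply/ffunP => l; apply: Ptilde_nat_inj.
rewrite wadd_gen_iter !ffunE inE.
by case: (eqVneq l i) => [->|_]; rewrite ?ir ?muln1 ?addn0 ?muln0.
Qed.

Lemma SMQSym_gen_inj : injective (@SMQSym_gen k m).
Proof.
move=> i i'; rewrite !SMQSym_genE => e.
have [/ffunP/(_ i)] := Mbar_inj (x1 := (_, _)) (x2 := (_, _)) e.
by rewrite !ffunE eqxx; case: eqP.
Qed.

(** * Existence and uniqueness of the extended morphism *)

Section Extension.
Variables (R : comAlgType k) (Q : R -> R) (f : 'I_m -> R).
Hypothesis Q_rb : rota_baxter 1 Q.

Definition wexp_eval w : R := \prod_(i < m) f i ^+ nat_of_Ntilde (val (w i)).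

Lemma wexp_evalM w w' : wexp_eval (wadd w w') = wexp_eval w * wexp_eval w'.
Proof.
rewrite -big_split; apply: eq_bigr => i _.
by rewrite ffunE /= nat_of_NtildeD exprD.
Qed.

Lemma wexp_eval_eps : wexp_eval (weps m) = 1.
Proof. by apply: big1 => i _; rewrite ffunE. Qed.

(** Prescribing [phi] on the basis makes it multiplicative, because [MbarM] and [rb_iterM] sum over
    the same quasi-shuffles. It commutes with the operators because [weps m] evaluates to 1. *)
Lemma rota_baxter_extension : exists phi : SMQSym k m -> R,
  rota_baxter_morphism P Q phi /\ forall i, phi (SMQSym_gen k i) = f i.
Proof.
have [phi [phi_lin phiE]] := Mbar_linear_ext
  (fun w u => wexp_eval w * rb_iter Q wexp_eval u : R) m_gt0.
have Plin := SMQSym_RBop_linear; have [Qlin _] := Q_rb.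
exists phi; split; last first.
  move=> i; rewrite SMQSym_genE phiE mulr1 /wexp_eval (bigD1 i) //= ffunE eqxx expr1.
  by rewrite big1 ?mulr1 // => l /negPf li; rewrite ffunE li.
split=> //.
- split; first by rewrite SMQSym1E phiE wexp_eval_eps mulr1.
  move=> x y; move: y; apply: SMQSym_linear_eq => [r g h|r g h|w' v].
  + by rewrite mulrDr -scalerAr phi_lin.
  + by rewrite phi_lin mulrDr -scalerAr.
  move: x; apply: SMQSym_linear_eq => [r g h|r g h|w u].
  + by rewrite mulrDl -scalerAl phi_lin.
  + by rewrite phi_lin mulrDl -scalerAl.
  rewrite MbarM (linear_big_sum phi_lin) !phiE mulrACA -wexp_evalM.
  rewrite (rb_iterM Q_rb wexp_evalM) mulr_sumr.
  by apply: eq_bigr => t _; rewrite phiE.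
- apply: SMQSym_linear_eq => [r g h|r g h|w u]; first by rewrite Plin phi_lin.
    by rewrite phi_lin Qlin.
  by rewrite SMQSym_RBopE !phiE wexp_eval_eps mul1r.
Qed.

End Extension.

Lemma rota_baxter_morphism_eq (R : comAlgType k) (Q : R -> R)
    (phi psi : SMQSym k m -> R) :
  rota_baxter_morphism P Q phi -> rota_baxter_morphism P Q psi ->
  (forall i, phi (SMQSym_gen k i) = psi (SMQSym_gen k i)) -> phi = psi.
Proof.
move=> [phi_lin [phi1 phiM] phiP] [psi_lin [psi1 psiM] psiP] gen_eq.
have prodE (chi : SMQSym k m -> R) : chi 1 = 1 -> {morph chi : x y / x * y} ->
    forall w, chi (Mbar k w [::]) = wexp_eval (chi \o @SMQSym_gen k m) w.
  move=> chi1 chiM w; rewrite MbarE (big_morph chi chiM chi1).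
  apply: eq_bigr => i _; elim: (nat_of_Ntilde _) => [|n IH]; first by rewrite !expr0.
  by rewrite !exprS chiM IH.
have monE w : phi (Mbar k w [::]) = psi (Mbar k w [::]).
  by rewrite !prodE //; apply: eq_bigr => i _; rewrite /= gen_eq.
(* The induction keeps [w] general: removing the operator turns the first letter [a] into the new
   exponent of column 0. *)
apply/funext; apply: SMQSym_linear_eq => // w u; elim: u w => [//|a u IH] w.
by rewrite Mbar_split phiM psiM monE -SMQSym_RBopE phiP psiP IH.
Qed.

End SMQSymFree.

Unset Implicit Arguments.

Theorem theorem4p9 (k : comNzRingType) (iota : {rmorphism rat -> k})
    (m : nat) (m_gt0 : (0 < m)%N)
    (Y : Type) (y : 'I_m -> Y) (y_bij : bijective y)
    (j : Y -> SMQSym k m) (jE : forall i : 'I_m, j (y i) = SMQSym_gen k i) :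
  injective j /\ free_com_rota_baxter 1 (@SMQSym_RBop k m) j.
Proof.
have [x yK xK] := y_bij; split.
  by move=> a b; rewrite -(xK a) -(xK b) !jE => /(SMQSym_gen_inj m_gt0) ->.
split=> [|R Q Q_rb f]; first exact: SMQSym_RBop_rota_baxter.
(* The bijection [y] transports [f] to the index set of the generators. *)
have [phi [phi_rb phi_gen]] := rota_baxter_extension m_gt0 (f \o y) Q_rb.
exists phi; split.
  by split=> //; apply/funext => a; rewrite /= -(xK a) jE phi_gen.
move=> psi [psi_rb psi_f]; apply: rota_baxter_morphism_eq phi_rb psi_rb _ => // i.
by rewrite phi_gen -psi_f /= jE.
Qed.
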